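(* Let $n\ge 2$ and let $\mathcal A_{n,1}:=\mathrm{span}(E_{1,j} : j=2,\dots,n)\subset\mathfrak{sl}(n,\mathbb R)$. Up to conjugation by elements of $\mathrm{GL}(n,\mathbb R)$, $\mathcal A_{n,1}$ is the unique MANS $\mathcal A$ of class $2$ of $\mathfrak{sl}(n,\mathbb R)$ such that $(\mathbb R\,\mathbb I_{\mathbb R^n}\oplus\mathcal A)\ltimes\mathbb R^n$ is a Frobenius Lie algebra. Equivalently, up to conjugation, it is the unique MANS $\mathcal A$ of $\mathfrak{sl}(n,\mathbb R)$ with Kravchuk signature $(n-1,0,1)$ such that $(\mathbb R\,\mathbb I_{\mathbb R^n}\oplus\mathcal A)\ltimes\mathbb R^n$ is Frobenius. In other words, up to isomorphism, $\mathcal G_{n,1}:=(\mathbb R\,\mathbb I_{\mathbb R^n}\oplus\mathcal A_{n,1})\ltimes\mathbb R^n$ is the unique 2-solvable Frobenius Lie algebra of the form $(\mathbb R\,\mathbb I_{\mathbb R^n}\oplus\mathcal A)\ltimes\mathbb R^n$ with $\mathcal A$ a MANS of class $2$ of $\mathfrak{sl}(n,\mathbb R)$.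
   Context: $E_{i,j}$ is the $n\times n$ matrix with $1$ in entry $(i,j)$ and $0$ elsewhere; $\mathbb I_{\mathbb R^n}$ is the identity. A MASA (maximal Abelian subalgebra) of a Lie algebra is a subalgebra equal to its own centralizer. A MANS (maximal Abelian nilpotent subalgebra) of $\mathfrak{sl}(n,\mathbb R)$ is a MASA of $\mathfrak{sl}(n,\mathbb R)$ all of whose elements are nilpotent matrices. A MANS $\mathcal A$ is of class $p\ge2$ if $a_1a_2\cdots a_p=0$ for all $a_1,\dots,a_p\in\mathcal A$ and there is some $a\in\mathcal A$ with $a^{p-1}\ne0$. Its Kravchuk signature is $(\nu,m,\mu)$ with $\nu=n-\dim(\mathcal A\mathbb R^n)$ (where $\mathcal A\mathbb R^n$ is the span of all $ax$, $a\in\mathcal A$, $x\in\mathbb R^n$), $\mu=\dim\ker\mathcal A$ with $\ker\mathcal A=\{x\in\mathbb R^n: ax=0\ \forall a\in\mathcal A\}$, and $m=n-\mu-\nu$. For an Abelian Lie subalgebra $\mathfrak{B}\subset\mathfrak{gl}(n,\mathbb R)$, $\mathfrak{B}\ltimes\mathbb R^n$ is the vector space $\mathfrak{B}\oplus\mathbb R^n$ with bracket $[a,b]=0$, $[x,y]=0$, $[a,x]=ax$ for $a,b\in\mathfrak{B}$, $x,y\in\mathbb R^n$. A Lie algebra $\mathcal G$ is Frobenius if there is $\alpha\in\mathcal G^*$ such that $\partial\alpha(u,v):=-\alpha([u,v])$ is nondegenerate on $\mathcal G$; it is 2-solvable if $[\mathcal G,\mathcal G]$ is Abelian. *)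

(* Defs.v *)
From HB Require Import structures.
From mathcomp Require Import all_boot all_order all_algebra ring.

Set Implicit Arguments.
Unset Strict Implicit.
Unset Printing Implicit Defensive.

Import GRing.Theory.
Local Open Scope ring_scope.

HB.mixin Record isLieAlgebra (F : fieldType) V of Vector F V := {
  lieb : V -> V -> V;
  lieb_linearl : forall w, linear (fun v => lieb v w);
  lieb_linearr : forall v, linear (lieb v);
  lieb_alt : forall v, lieb v v = 0;
  lieb_jacobi : forall u v w,
    lieb u (lieb v w) + lieb v (lieb w u) + lieb w (lieb u v) = 0
}.

#[short(type="lieAlgType")]
HB.structure Definition LieAlgebra (F : fieldType) :=
  { V of isLieAlgebra F V & Vector F V }.

Section LieTheory.
Variables (F : fieldType) (L : lieAlgType F).
Implicit Types (S A U V : {vspace L}).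

Definition lie_abelian U : Prop :=
  forall u v : L, u \in U -> v \in U -> lieb u v = 0.

Definition lie_closed U : Prop :=
  forall u v : L, u \in U -> v \in U -> lieb u v \in U.

Definition in_centralizer S A (x : L) : Prop :=
  x \in S /\ forall a : L, a \in A -> lieb x a = 0.

(* [S] is meant to be a Lie subalgebra of [L]; [masa S A] says that [A] is a
   MASA of the Lie algebra [S]. *)
Definition masa S A : Prop :=
  [/\ (A <= S)%VS, lie_closed A
    & forall x : L, x \in A <-> in_centralizer S A x].

Lemma masa_abelian S A : masa S A -> lie_abelian A.
Proof. by move=> [_ _ cA] u v /cA[_ cu] /cu. Qed.

Lemma lieb_bigl I (r : seq I) (G : I -> L) (c : I -> F) w :
  lieb (\sum_(i <- r) c i *: G i) w = \sum_(i <- r) c i *: lieb (G i) w.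
Proof.
elim: r => [|i r IH]; last by rewrite !big_cons lieb_linearl IH.
rewrite !big_nil; have := lieb_linearl w (-1) 0 0.
by rewrite !scaleN1r oppr0 addr0 addNr.
Qed.

Lemma lieb_bigr I (r : seq I) (G : I -> L) (c : I -> F) v :
  lieb v (\sum_(i <- r) c i *: G i) = \sum_(i <- r) c i *: lieb v (G i).
Proof.
elim: r => [|i r IH]; last by rewrite !big_cons lieb_linearr IH.
rewrite !big_nil; have := lieb_linearr v (-1) 0 0.
by rewrite !scaleN1r oppr0 addr0 addNr.
Qed.

(* The span [U, V] of all brackets, computed on bases as [prodv] does for
   algebras; see [lieprodv_sub]. *)
Definition lieprodv U V : {vspace L} :=
  <<[seq lieb u v | u <- vbasis U, v <- vbasis V]>>%VS.

Lemma lieprodv_sub U V (W : {vspace L}) :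
  (lieprodv U V <= W)%VS <->
  forall u v, u \in U -> v \in V -> lieb u v \in W.
Proof.
split=> [/span_subvP sUVW u v Uu Vv | UVW]; last first.
  apply/span_subvP => _ /allpairsP[[u v] /= [/vbasis_mem Uu /vbasis_mem Vv ->]].
  exact: UVW.
rewrite (coord_vbasis Uu) lieb_bigl rpred_sum // => i _.
rewrite rpredZ // (coord_vbasis Vv) lieb_bigr rpred_sum // => j _.
rewrite rpredZ // sUVW //; apply/allpairsP.
by exists ((vbasis U)`_i, (vbasis V)`_j); rewrite !mem_nth ?size_tuple.
Qed.

Definition two_solvable : Prop := lie_abelian (lieprodv fullv fullv).

Definition dform (alpha : 'Hom(L, F^o)) (u v : L) : F := - alpha (lieb u v).

Definition frobenius : Prop :=
  exists alpha : 'Hom(L, F^o),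
    forall u : L, (forall v : L, dform alpha u v = 0) -> u = 0.

End LieTheory.

Arguments two_solvable {F} L.
Arguments frobenius {F} L.

Definition lie_isomorphic (F : fieldType) (L L' : lieAlgType F) : Prop :=
  exists f : {linear L -> L'},
    bijective f /\ forall u v : L, f (lieb u v) = lieb (f u) (f v).

(* The bracket of the semidirect product below is a Lie bracket only for an
   abelian [B], so abelian subspaces are bundled. Every MASA is one, by
   [masa_abelian]. *)
Record abelianSub (F : fieldType) (L : lieAlgType F) := AbelianSub {
  abelian_space :> {vspace L};
  abelianSubP : lie_abelian abelian_space
}.

Section Gl.
Variables (F : fieldType) (n : nat).
Implicit Types a b c : 'M[F]_n.

Definition commutator a b : 'M[F]_n := a *m b - b *m a.

Fact commutator_linearl c : linear (fun a => commutator a c).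
Proof.
move=> k a b; rewrite /commutator mulmxDl mulmxDr -scalemxAl -scalemxAr.
by rewrite scalerBr opprD addrACA.
Qed.

Fact commutator_linearr c : linear (commutator c).
Proof.
move=> k a b; rewrite /commutator mulmxDl mulmxDr -scalemxAl -scalemxAr.
by rewrite scalerBr opprD addrACA.
Qed.

Fact commutator_alt a : commutator a a = 0.
Proof. exact: subrr. Qed.

Fact commutator_jacobi a b c :
  commutator a (commutator b c) + commutator b (commutator c a)
    + commutator c (commutator a b) = 0.
Proof.
rewrite /commutator !mulmxBr !mulmxBl !mulmxA !opprB.
by apply/matrixP => i j; rewrite !mxE; ring.
Qed.

HB.instance Definition _ := isLieAlgebra.Build F 'M[F]_n
  commutator_linearl commutator_linearr commutator_alt commutator_jacobi.

Definition sl : {vspace 'M[F]_n} := lker (linfun (@mxtrace F n : _ -> F^o)).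

Lemma mem_sl a : (a \in sl) = (\tr a == 0).
Proof. by rewrite memv_ker lfunE. Qed.

Definition nilpotent_mx a : Prop := exists k : nat, a ^+ k = 0.

Definition mans (A : {vspace 'M[F]_n}) : Prop :=
  masa sl A /\ forall a, a \in A -> nilpotent_mx a.

(* Products and powers are those of the (possibly trivial) ring ['M_n]. *)
Definition mans_of_class (p : nat) (A : {vspace 'M[F]_n}) : Prop :=
  [/\ mans A, (2 <= p)%N,
      forall a : 'I_p -> 'M[F]_n,
        (forall i, a i \in A) -> \prod_(i < p) a i = 0
    & exists2 a : 'M[F]_n, a \in A & a ^+ p.-1 != 0].

(* The span of all [a *m x], computed on bases; see [mxact_span_sub]. *)
Definition mxact_span (A : {vspace 'M[F]_n}) : {vspace 'cV[F]_n} :=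
  <<[seq a *m x | a <- vbasis A, x <- vbasis {:'cV[F]_n}]>>%VS.

Lemma mxact_span_sub A (W : {vspace 'cV[F]_n}) :
  (mxact_span A <= W)%VS <->
  forall a (x : 'cV[F]_n), a \in A -> a *m x \in W.
Proof.
split=> [/span_subvP sAW a x Aa | AW]; last first.
  apply/span_subvP => _ /allpairsP[[a x] /= [/vbasis_mem Aa _ ->]].
  exact: AW.
rewrite (coord_vbasis Aa) (coord_vbasis (memvf x)) mulmx_suml.
rewrite rpred_sum // => i _; rewrite -scalemxAl mulmx_sumr rpredZ //.
rewrite rpred_sum // => j _; rewrite -scalemxAr rpredZ // sAW //.
apply/allpairsP; exists ((vbasis A)`_i, (vbasis {:'cV[F]_n})`_j).
by rewrite !mem_nth ?size_tuple.
Qed.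

(* The common kernel, computed on a basis; see [mem_common_ker]. *)
Definition common_ker (A : {vspace 'M[F]_n}) : {vspace 'cV[F]_n} :=
  (\bigcap_(a <- vbasis A) lker (linfun (mulmx a : 'cV[F]_n -> 'cV[F]_n)))%VS.

Lemma mem_common_ker A (x : 'cV[F]_n) :
  x \in common_ker A <-> forall a, a \in A -> a *m x = 0.
Proof.
have kerP (s : seq 'M[F]_n) :
    x \in (\bigcap_(a <- s)
             lker (linfun (mulmx a : 'cV[F]_n -> 'cV[F]_n)))%VS
    = all (fun a => a *m x == 0) s.
  elim: s => [|a s IH]; first by rewrite big_nil memvf.
  by rewrite big_cons memv_cap IH memv_ker lfunE.
rewrite /common_ker kerP; split=> [/allP kx a Aa | kx].
  rewrite (coord_vbasis Aa) mulmx_suml big1 // => i _.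
  have /eqP ax0 : (vbasis A)`_i *m x == 0.
    by apply: kx; rewrite mem_nth ?size_tuple.
  by rewrite -scalemxAl ax0 scaler0.
by apply/allP => a /vbasis_mem Aa; rewrite kx.
Qed.

(* The middle entry is an integer because [mu + nu <= n] may fail for an
   arbitrary subspace; [nu] involves no truncation. *)
Definition kravchuk_signature (A : {vspace 'M[F]_n}) : nat * int * nat :=
  let nu := (n - \dim (mxact_span A))%N in
  let mu := \dim (common_ker A) in
  (nu, n%:Z - mu%:Z - nu%:Z, mu).

Definition mx_conjugate (A A' : {vspace 'M[F]_n}) : Prop :=
  exists2 P : 'M[F]_n, P \in unitmx &
    forall b, b \in A' <-> exists2 a, a \in A & b = P *m a *m invmx P.

End Gl.

Section Semidirect.
Variables (F : fieldType) (n : nat) (B : abelianSub 'M[F]_n).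

Definition semidirect : Type := (subvs_of B * 'cV[F]_n)%type.

HB.instance Definition _ :=
  Vector.copy semidirect (subvs_of B * 'cV[F]_n)%type.

(* [a, y] - [b, x], as [a, b] = 0 and [x, y] = 0. *)
Definition semidirect_bracket (u v : semidirect) : semidirect :=
  (0, vsval u.1 *m v.2 - vsval v.1 *m u.2).

Fact semidirect_linearl w : linear (fun u => semidirect_bracket u w).
Proof.
move=> k u v; congr pair; first by rewrite /= scaler0 addr0.
rewrite /= mulmxDl mulmxDr -scalemxAl -scalemxAr.
by rewrite scalerBr opprD addrACA.
Qed.

Fact semidirect_linearr u : linear (semidirect_bracket u).
Proof.
move=> k v w; congr pair; first by rewrite /= scaler0 addr0.
rewrite /= mulmxDl mulmxDr -scalemxAl -scalemxAr.
by rewrite scalerBr opprD addrACA.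
Qed.

Fact semidirect_alt u : semidirect_bracket u u = 0.
Proof. by rewrite /semidirect_bracket subrr. Qed.

Fact semidirect_jacobi u v w :
  semidirect_bracket u (semidirect_bracket v w)
    + semidirect_bracket v (semidirect_bracket w u)
    + semidirect_bracket w (semidirect_bracket u v) = 0.
Proof.
have mulC (a b : subvs_of B) : vsval a *m vsval b = vsval b *m vsval a.
  by apply/eqP; rewrite -subr_eq0; apply/eqP/abelianSubP; apply: subvsP.
case: u v w => [a x] [b y] [c z]; congr pair; first by rewrite /= !addr0.
rewrite /= !mul0mx !subr0 !mulmxBr !mulmxA.
rewrite (mulC c a) (mulC b a) (mulC c b).
by apply/matrixP => i j; rewrite !mxE; ring.
Qed.

HB.instance Definition _ := isLieAlgebra.Build F semidirect
  semidirect_linearl semidirect_linearr semidirect_alt semidirect_jacobi.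

End Semidirect.

Section ScalarExtension.
Variables (F : fieldType) (n : nat).

Fact scalar_ext_abelian (A : abelianSub 'M[F]_n) :
  lie_abelian (<[1%:M]> + A)%VS.
Proof.
move=> _ _ /memv_addP[_ /vlineP[k ->] [a Aa ->]]
  /memv_addP[_ /vlineP[l ->] [b Ab ->]].
have ab : a *m b = b *m a.
  by apply/eqP; rewrite -subr_eq0; apply/eqP/(abelianSubP Aa Ab).
rewrite /lieb /= /commutator !mulmxDl !mulmxDr -!scalemxAl -!scalemxAr.
rewrite !mul1mx !mulmx1 ab.
by apply/matrixP => i j; rewrite !mxE; ring.
Qed.

Definition scalar_ext (A : abelianSub 'M[F]_n) : abelianSub 'M[F]_n :=
  AbelianSub (@scalar_ext_abelian A).

(* The Lie algebra (F I + A) |>< F^n. *)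
Definition affine_ext (A : abelianSub 'M[F]_n) : lieAlgType F :=
  semidirect (scalar_ext A).

(* Indices are counted from 0, so this is the span A_{n,1} of the
   E_{1,j} for j = 2, .., n. *)
Definition first_row_space : {vspace 'M[F]_n} :=
  (\sum_(ij : 'I_n * 'I_n | (ij.1 == 0%N :> nat) && (0 < ij.2)%N)
     <[delta_mx ij.1 ij.2]>)%VS.

Fact first_row_space_abelian : lie_abelian first_row_space.
Proof.
have mul0 (a b : 'M[F]_n) :
    a \in first_row_space -> b \in first_row_space -> a *m b = 0.
  move=> /memv_sumP[f Af ->] /memv_sumP[g Ag ->].
  rewrite mulmx_suml big1 // => ij Pij; rewrite mulmx_sumr big1 // => kl Pkl.
  have /vlineP[s ->] := Af ij Pij; have /vlineP[t ->] := Ag kl Pkl.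
  rewrite -scalemxAl -scalemxAr mul_delta_mx_0 ?scaler0 //.
  case/andP: Pij => _ j_gt0; case/andP: Pkl => /eqP k0 _.
  by apply/eqP => jk; rewrite jk k0 in j_gt0.
by move=> a b Aa Ab; rewrite /lieb /= /commutator !mul0 // subrr.
Qed.

Definition An1 : abelianSub 'M[F]_n := AbelianSub first_row_space_abelian.

End ScalarExtension.

Arguments An1 F n : clear implicits.

(* [x0] is, up to [E], the unique [x] satisfying [P]. *)
Definition unique_up_to (T : Type) (E : T -> T -> Prop) (P : T -> Prop)
    (x0 : T) : Prop :=
  P x0 /\ forall x, P x -> E x x0.

(* Main.v *)
(* The form of [affine_ext A] given by [alpha] pairs [B = F I + A] with [F^n] by
   [(b, x) |-> phi b x], where [phi] is the restriction of [alpha] to [F^n]; so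
   the Lie algebra is Frobenius iff some row [phi] makes this pairing perfect.
   If moreover [A A = 0], then [phi A] is a hyperplane of rows killed by [A]
   and [A] is the space of all dyads [v w] with [w v = 0], for a column [v] with
   [phi v = 1]. All nonzero columns are conjugate, hence so are these spaces. *)
From HB Require Import structures.
Require Import Defs.
From mathcomp Require Import all_boot all_order all_algebra reals zify.

Set Implicit Arguments.
Unset Strict Implicit.
Unset Printing Implicit Defensive.

Local Open Scope ring_scope.

Import GRing.Theory Num.Theory.

(** * Dual rows, annihilators, and transitivity on nonzero columns *)

Section ColumnVectors.
Variables (F : fieldType) (n : nat).
Implicit Types (v x : 'cV[F]_n) (w : 'rV[F]_n).

Lemma exists_dual v : v != 0 -> exists w, w *m v = 1%:M.
Proof.
case/matrix0Pn=> i [j]; rewrite ord1 => vi.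
exists ((v i 0)^-1 *: delta_mx 0 i); rewrite -scalemxAl -rowE.
by rewrite [X in _ *: X]mx11_scalar mxE scale_scalar_mx mulVf.
Qed.

Lemma exists_codual w : w != 0 -> exists x, w *m x = 1%:M.
Proof.
rewrite -trmx_eq0 => /matrix0Pn[i [j]]; rewrite ord1 mxE => wi.
exists ((w 0 i)^-1 *: delta_mx i 0); rewrite -scalemxAr -colE.
by rewrite [X in _ *: X]mx11_scalar mxE scale_scalar_mx mulVf.
Qed.

Lemma exists_annihilator v :
  (2 <= n)%N -> exists2 w : 'rV[F]_n, w != 0 & w *m v = 0.
Proof.
move=> hn; have : kermx v != 0 :> 'M_n.
  rewrite -mxrank_eq0 mxrank_ker subn_eq0 -ltnNge.
  exact: leq_ltn_trans (rank_leq_col v) hn.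
by case/rowV0Pn=> w /sub_kermxP wv w0; exists w.
Qed.

Lemma eq0_mulmx_row x : (forall w, w *m x = 0) -> x = 0.
Proof.
by move=> x0; apply/row_matrixP => i; rewrite rowE x0 row0.
Qed.

(** Both columns are compared with [pid_mx 1]. In the rank factorization of a nonzero column,
    [row_ebase] is a nonzero scalar, which is moved into the invertible factor [col_ebase]. *)
Lemma unitmx_transitive (v v' : 'cV[F]_n) :
  v != 0 -> v' != 0 -> exists2 P : 'M[F]_n, P \in unitmx & P *m v = v'.
Proof.
have base (u : 'cV[F]_n) : u != 0 ->
    exists2 P : 'M[F]_n, P \in unitmx & P *m pid_mx 1 = u.
  move=> u0; have rk1 : \rank u = 1%N.
    by apply/eqP; rewrite eqn_leq rank_leq_col lt0n mxrank_eq0.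
  have := row_ebase_unit u; rewrite [row_ebase u]mx11_scalar.
  set c := row_ebase u 0 0; rewrite unitmxE det_scalar1 => c0.
  exists (c *: col_ebase u).
    by rewrite unitmxZ // col_ebase_unit.
  rewrite -{2}[u]mulmx_ebase rk1 [row_ebase u]mx11_scalar -/c.
  by rewrite mul_mx_scalar scalemxAl.
move=> /base[P uP <-] /base[Q uQ <-]; exists (Q *m invmx P).
  by rewrite unitmx_mul uQ unitmx_inv.
by rewrite -mulmxA mulKmx.
Qed.

End ColumnVectors.

(** * Spaces of traceless dyads with a fixed column *)

Section Dyads.
Variables (F : fieldType) (n : nat).
Implicit Types (v x : 'cV[F]_n) (w phi : 'rV[F]_n) (a b : 'M[F]_n).
Implicit Types A : {vspace 'M[F]_n}.

(** The entry of [w *m v] is the trace of [v *m w], so these are the traceless dyads with column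
    [v]. *)
Definition dyad_space v A : Prop :=
  forall a, a \in A <-> exists2 w : 'rV[F]_n, w *m v = 0 & a = v *m w.

Lemma dyad_space_mul0 v A a b :
  dyad_space v A -> a \in A -> b \in A -> a *m b = 0.
Proof.
move=> dA /dA[w wv ->] /dA[w' w'v ->].
by rewrite mulmxA -(mulmxA v) wv mulmx0 mul0mx.
Qed.

(** If [P v = v'], conjugation by [P] turns [v w] into [v' (w P^-1)], and [w P^-1] kills [v']
    exactly when [w] kills [v]. *)
Lemma dyad_space_conjugate v v' A (A' : {vspace 'M[F]_n}) :
  v != 0 -> v' != 0 -> dyad_space v A -> dyad_space v' A' -> mx_conjugate A A'.
Proof.
move=> v0 v'0 dA dA'; have [P uP Pv] := unitmx_transitive v0 v'0.
exists P => // b; split.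
  case/dA'=> w wv' ->; exists (v *m (w *m P)).
    by apply/dA; exists (w *m P); rewrite // -mulmxA Pv.
  by rewrite !mulmxA Pv mulmxK.
case=> a /dA[w wv ->] ->; apply/dA'; exists (w *m invmx P).
  by rewrite -Pv -mulmxA mulKmx.
by rewrite !mulmxA Pv.
Qed.

(* Matrices commuting with all the dyads are of the form [c + v u]; their
   trace is [n c]. *)
Lemma dyad_space_mans v A :
  (2 <= n)%N -> n%:R != 0 :> F -> v != 0 -> dyad_space v A -> mans A.
Proof.
move=> hn nF v0 dA.
have sAsl : (A <= sl F n)%VS.
  apply/subvP => a /dA[w wv ->].
  by rewrite mem_sl mxtrace_mulC wv mxtrace0.
have [phi phiv] := exists_dual v0.
split; first split=> //.
- move=> a b Aa Ab; rewrite /lieb /= /commutator.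
  by rewrite !(dyad_space_mul0 dA) ?subrr ?mem0v.
- move=> x; split=> [Ax | [slx cx]].
    split; first exact: (subvP sAsl).
    by move=> a Aa; rewrite /lieb /= /commutator !(dyad_space_mul0 dA) ?subrr.
  have comm (w : 'rV[F]_n) : w *m v = 0 -> x *m v *m w = v *m (w *m x).
    move=> wv; apply/eqP; rewrite !mulmxA -subr_eq0 -(mulmxA x).
    apply/eqP/cx/dA.
    by exists w.
  have [w w0 wv] := exists_annihilator v hn.
  have [y wy] := exists_codual w0.
  (* This is the eigenvalue of [x] at [v]: as [w y = 1], commutation gives
     [x v = (x v w) y = v (w x y)]. *)
  pose c := (w *m x *m y) 0 0.
  have xv : x *m v = c *: v.
    rewrite -[LHS]mulmx1 -wy mulmxA comm // -mulmxA [w *m x *m y]mx11_scalar.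
    by rewrite mul_mx_scalar.
  have wx (u : 'rV[F]_n) : u *m v = 0 -> u *m x = c *: u.
    move=> uv; rewrite -[LHS]mul1mx -phiv -mulmxA -comm // xv -scalemxAl.
    by rewrite -scalemxAr mulmxA phiv mul1mx.
  pose u := phi *m x - c *: phi.
  have uv : u *m v = 0.
    by rewrite mulmxBl -mulmxA xv -scalemxAr scalemxAl subrr.
  have xE : x = c%:M + v *m u.
    (* Split [e] as [(e - (e v) phi) + (e v) phi]: the first part kills [v], so [x] multiplies it by
       [c], and [phi x = c phi + u]. *)
    apply/row_matrixP => i; rewrite !rowE; set e := delta_mx _ _ : 'rV_n.
    have := wx (e - e *m v *m phi); rewrite mulmxBl -!mulmxA phiv mulmx1 subrr.
    move=> /(_ erefl) /eqP; rewrite mulmxBl subr_eq => /eqP ->.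
    rewrite mulmxDr mul_mx_scalar /u !mulmxBr scalerBr -!mulmxA.
    by rewrite -!scalemxAr addrAC addrA addrAC.
  have c0 : c = 0.
    move: slx; rewrite mem_sl xE mxtraceD mxtrace_scalar mxtrace_mulC uv.
    by rewrite mxtrace0 addr0 -mulr_natr mulf_eq0 (negbTE nF) orbF => /eqP.
  by apply/dA; exists u; rewrite // xE c0 raddf0 add0r.
- by move=> a Aa; exists 2%N; rewrite expr2 -mulmxE (dyad_space_mul0 dA).
Qed.

Lemma dyad_space_class2 v A :
  (2 <= n)%N -> n%:R != 0 :> F -> v != 0 -> dyad_space v A -> mans_of_class 2 A.
Proof.
move=> hn nF v0 dA; split=> //; first exact: dyad_space_mans dA.
  move=> a Aa; rewrite !big_ord_recl big_ord0 mulr1 -mulmxE.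
  by rewrite (dyad_space_mul0 dA).
have [w w0 wv] := exists_annihilator v hn; have [phi phiv] := exists_dual v0.
exists (v *m w); first by apply/dA; exists w.
rewrite expr1; apply: contraNneq w0 => /(congr1 (mulmx phi)).
by rewrite mulmxA phiv mul1mx mulmx0 => ->.
Qed.

(** The image span and the common kernel are both the line through [v]. *)
Lemma dyad_space_signature v A :
  (2 <= n)%N -> v != 0 -> dyad_space v A ->
  kravchuk_signature A = (n.-1, 0, 1%N).
Proof.
move=> hn v0 dA.
have [w w0 wv] := exists_annihilator v hn; have [phi phiv] := exists_dual v0.
have imE : mxact_span A = <[v]>%VS.
  apply/eqP; rewrite eqEsubv; apply/andP; split.
    apply/mxact_span_sub => _ x /dA[u _ ->].
    by rewrite -mulmxA [u *m x]mx11_scalar mul_mx_scalar memvZ ?memv_line.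
  have [y wy] := exists_codual w0.
  have /mxact_span_sub im := subvv (mxact_span A).
  have := im (v *m w) y; rewrite -mulmxA wy mulmx1 -memvE; apply.
  by apply/dA; exists w.
have kerE : common_ker A = <[v]>%VS.
  apply/eqP; rewrite eqEsubv; apply/andP; split.
    apply/subvP => x /mem_common_ker kx.
    have ann (u : 'rV[F]_n) : u *m v = 0 -> u *m x = 0.
      move=> uv; rewrite -[u]mul1mx -phiv -mulmxA -mulmxA mulmxA.
      by rewrite -mulmxA [v *m _]mulmxA kx ?mulmx0 //; apply/dA; exists u.
    (* For every row [e], the row [e - (e v) phi] kills [v], hence [x]; so [e x = (e v) (phi x)]. *)
    apply/vlineP; exists ((phi *m x) 0 0); apply/eqP; rewrite -subr_eq0.
    apply/eqP/eq0_mulmx_row => e.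
    rewrite mulmxBr -mul_mx_scalar -mx11_scalar !mulmxA -mulmxBl.
    by apply: ann; rewrite mulmxBl -!mulmxA phiv mulmx1 subrr.
  rewrite -memvE; apply/mem_common_ker => _ /dA[u uv ->].
  by rewrite -mulmxA uv mulmx0.
rewrite /kravchuk_signature imE kerE !dim_vline v0 /= subn1.
congr (_, _, _); case: n hn => // k _.
by rewrite -addrA -opprD [X in _ - X]addrC /= -[in X in X - _]addn1 PoszD subrr.
Qed.

(* [dim A F^n = 1] makes every [a] in [A] a dyad [v w], and [tr a = w v]. *)
Lemma signature_class2 A :
  (2 <= n)%N -> mans A -> kravchuk_signature A = (n.-1, 0, 1%N) ->
  mans_of_class 2 A.
Proof.
move=> hn mA [nu _ _].
(* As [n.-1] is positive, the truncated difference defining [nu] is exact. *)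
have dim1 : \dim (mxact_span A) = 1%N.
  by move: hn nu; clear; case: n (\dim _) => // k d; lia.
have [v span_v] : exists v, mxact_span A = <[v]>%VS.
  exists (vpick (mxact_span A)); apply/esym/eqP.
  by rewrite eqEdim -memvE memv_pick dim_vline vpick0 -dimv_eq0 dim1.
have rank1 a : a \in A -> exists w, a = v *m w.
  move=> Aa; exists (\row_j (coord [tuple v] 0 (col j a))).
  apply/matrixP => i j; rewrite mxE big_ord1 !mxE.
  have : col j a \in <[v]>%VS.
    rewrite colE -span_v; have /mxact_span_sub := subvv (mxact_span A); exact.
  rewrite -span_seq1 => /coord_span; rewrite big_ord1 /= => /colP/(_ i).
  by rewrite !mxE mulrC.
have prod0 a b : a \in A -> b \in A -> a *m b = 0.
  move=> Aa /rank1[w' ->]; have [w aE] := rank1 a Aa.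
  have /eqP tr0 : \tr a == 0.
    by rewrite -mem_sl; case: mA => [[/subvP sA _ _] _]; apply: sA.
  rewrite aE mulmxA -(mulmxA v) [w *m v]mx11_scalar.
  by rewrite -trace_mx11 mxtrace_mulC -aE tr0 raddf0 mulmx0 mul0mx.
split=> //.
  by move=> a Aa; rewrite !big_ord_recl big_ord0 mulr1 -mulmxE prod0.
(* [vpick A] is nonzero unless [A = 0], and then the image span would be 0 instead of a line. *)
exists (vpick A); first exact: memv_pick.
rewrite expr1 vpick0; apply: contra_eq_neq dim1 => A0.
rewrite (_ : mxact_span A = 0%VS) ?dimv0 //; apply/eqP.
rewrite -subv0; apply/mxact_span_sub => a x.
by rewrite A0 memv0 => /eqP ->; rewrite mul0mx mem0v.
Qed.

End Dyads.

(** * Frobenius forms and derived algebra of a semidirect product *)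

Section Frobenius.
Variables (F : fieldType) (n : nat) (B : abelianSub 'M[F]_n).

(** The bracket of [(0, x)] with [(b, y)] is [(0, - b x)], so an [x] with all [phi b x = 0] puts
    [(0, x)] in the radical of the form. *)
Lemma frobenius_row : frobenius (semidirect B) ->
  exists phi : 'rV[F]_n, forall x : 'cV[F]_n,
    (forall b, b \in B -> phi *m (b *m x) = 0) -> x = 0.
Proof.
case=> alpha ndeg; pose g (x : 'cV[F]_n) : F := alpha ((0, x) : semidirect B).
have gD x y : g (x + y) = g x + g y.
  by rewrite /g -[RHS]linearD; congr (alpha _); congr pair; rewrite /= addr0.
have gZ c x : g (c *: x) = c * g x.
  rewrite /g; transitivity (alpha (c *: ((0, x) : semidirect B))).
    by congr (alpha _); congr pair; rewrite /= scaler0.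
  by rewrite linearZ.
have g0 : g 0 = 0 by rewrite -(scale0r 0) gZ mul0r.
have gN x : g (- x) = - g x by rewrite -scaleN1r gZ mulN1r.
pose phi := \row_i g (delta_mx i 0).
have phiE x : phi *m x = (g x)%:M.
  rewrite [LHS]mx11_scalar; congr _%:M; rewrite mxE.
  rewrite [in RHS](matrix_sum_delta x) (big_morph g gD g0); apply: eq_bigr => i _.
  by rewrite big_ord1 gZ mxE mulrC.
exists phi => x x0.
suff /(congr1 snd) : ((0, x) : semidirect B) = 0 by [].
apply: ndeg => -[b y]; rewrite /dform /lieb /= /semidirect_bracket /=.
rewrite mul0mx sub0r.
have := x0 _ (subvsP b); rewrite phiE -[alpha _]/(g (- (vsval b *m x))).
move=> /matrixP/(_ 0 0); rewrite !mxE mulr1n => gbx.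
by rewrite gN gbx !oppr0.
Qed.

(** The functional extending [phi] by 0 on [B]; brackets lie in [F^n], so any other extension gives
    the same form. *)
Definition row_form (phi : 'rV[F]_n) (u : semidirect B) : F^o :=
  (phi *m u.2) 0 0.

Fact row_form_linear phi : linear (row_form phi).
Proof. by move=> c u v; rewrite /row_form /= mulmxDr -scalemxAr !mxE. Qed.

HB.instance Definition _ phi :=
  GRing.isLinear.Build F (semidirect B) F^o _ (row_form phi)
    (row_form_linear phi).

(** Pairing a radical element [(b, x)] with all [(0, y)] gives [phi b = 0]; pairing it with all
    [(c, 0)] gives [phi c x = 0]. *)
Lemma row_frobenius (phi : 'rV[F]_n) :
  (forall b, b \in B -> phi *m b = 0 -> b = 0) ->
  (forall x : 'cV[F]_n,
     (forall b, b \in B -> phi *m (b *m x) = 0) -> x = 0) ->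
  frobenius (semidirect B).
Proof.
move=> injl injr; exists (linfun (row_form phi)) => -[b x] u0.
have phi0 (c : subvs_of B) y : phi *m (vsval b *m y - vsval c *m x) = 0.
  rewrite [LHS]mx11_scalar -[RHS](raddf0 (@scalar_mx F 1)); congr _%:M.
  have := u0 ((c, y) : semidirect B).
  by rewrite /dform lfunE => /eqP; rewrite oppr_eq0 => /eqP.
congr pair.
  apply/val_inj/injl; first exact: subvsP.
  apply/trmx_inj/row_matrixP => i; rewrite trmx0 row0 -tr_col colE.
  have := phi0 0 (delta_mx i 0); rewrite linear0 mul0mx subr0 mulmxA => ->.
  exact: trmx0.
apply: injr => c Bc; apply/eqP; rewrite -oppr_eq0 -mulmxN -[- _]sub0r.
by rewrite -{1}(mulmx0 _ (vsval b)) -(vsprojK Bc) phi0.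
Qed.

(** Brackets have first component 0, and two such elements commute. *)
Lemma semidirect_two_solvable : two_solvable (semidirect B : lieAlgType F).
Proof.
have der (u : semidirect B) :
    u \in lieprodv {:semidirect B} fullv -> u.1 = 0 :> subvs_of B.
  pose K := lker (linfun (fst : semidirect B -> subvs_of B)).
  have /subvP sK : (lieprodv {:semidirect B} fullv <= K)%VS.
    by apply/lieprodv_sub => v w _ _; rewrite memv_ker lfunE.
  by move=> /sK; rewrite memv_ker lfunE => /eqP.
move=> u v /der u0 /der v0; rewrite /lieb /= /semidirect_bracket u0 v0.
by rewrite linear0 !mul0mx subrr.
Qed.

End Frobenius.

(** * Conjugate subspaces give isomorphic Lie algebras *)

Lemma scalar_ext_conjugate (F : fieldType) (n : nat)
    (A A' : abelianSub 'M[F]_n) :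
  mx_conjugate A A' -> mx_conjugate (scalar_ext A) (scalar_ext A').
Proof.
case=> P uP PA; exists P => // b; split.
  case/memv_addP=> _ /vlineP[c ->] [_ /PA[a Aa ->] ->].
  exists (c *: 1%:M + a); first by rewrite memv_add ?memvZ ?memv_line.
  by rewrite mulmxDr mulmxDl -scalemxAr mulmx1 -scalemxAl mulmxV.
case=> _ /memv_addP[_ /vlineP[c ->] [a Aa ->]] ->.
rewrite mulmxDr mulmxDl -scalemxAr mulmx1 -scalemxAl mulmxV //.
by rewrite memv_add ?memvZ ?memv_line //; apply/PA; exists a.
Qed.

Section ConjugationMap.
Variables (F : fieldType) (n : nat) (B B' : abelianSub 'M[F]_n).
Variable P : 'M[F]_n.

(** [vsproj] makes the map total and linear for every [P]; it is conjugation on the first factor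
    once [P] carries [B] into [B']. *)
Definition conj_map (u : semidirect B) : semidirect B' :=
  (vsproj B' (P *m vsval u.1 *m invmx P), P *m u.2).

Fact conj_map_linear : linear conj_map.
Proof.
move=> c u v; congr pair; last by rewrite /= mulmxDr -scalemxAr.
by rewrite [LHS]/= linearP mulmxDl -scalemxAl linearP.
Qed.

HB.instance Definition _ :=
  GRing.isLinear.Build F (semidirect B) (semidirect B') _ conj_map
    conj_map_linear.

End ConjugationMap.

Lemma conjugate_isomorphic (F : fieldType) (n : nat)
    (B B' : abelianSub 'M[F]_n) :
  mx_conjugate B B' -> lie_isomorphic (semidirect B) (semidirect B').
Proof.
case=> P uP PB.
have valK (b : subvs_of B) :
    vsval (vsproj B' (P *m vsval b *m invmx P)) = P *m vsval b *m invmx P.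
  by rewrite vsprojK //; apply/PB; exists (vsval b); rewrite ?subvsP.
have valK' (b : subvs_of B') :
    vsval (vsproj B (invmx P *m vsval b *m invmx (invmx P)))
      = invmx P *m vsval b *m invmx (invmx P).
  have [a Ba bE] := (PB _).1 (subvsP b).
  by rewrite vsprojK // invmxK bE !mulmxA mulVmx // mul1mx mulmxKV.
exists (conj_map B' P); split.
  exists (conj_map B (invmx P)) => -[b x];
    congr pair; rewrite ?mulKmx ?mulKVmx //.
    apply: val_inj; rewrite /= valK' valK invmxK !mulmxA.
    by rewrite mulVmx // mul1mx mulmxKV.
  apply: val_inj; rewrite /= valK valK' invmxK !mulmxA.
  by rewrite mulmxV // mul1mx mulmxK.
move=> [b x] [c y]; congr pair.
  by rewrite /= !(linear0, mul0mx).
by rewrite /= !valK mulmxBr -!mulmxA !mulKmx.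
Qed.

(** * Dyad spaces and the Frobenius condition in class 2 *)

Section Uniqueness.
Variables (F : fieldType) (n : nat).
Implicit Types (v : 'cV[F]_n) (A : abelianSub 'M[F]_n).

Lemma scalar_extP A b :
  b \in scalar_ext A <-> exists c, exists2 a, a \in A & b = c%:M + a.
Proof.
split=> [/memv_addP[_ /vlineP[c ->] [a Aa ->]] | [c [a Aa ->]]].
  by exists c, a; rewrite // scale_scalar_mx mulr1.
by rewrite memv_add // -[c]mulr1 -scale_scalar_mx memvZ ?memv_line.
Qed.

(* With [phi v = 1], the form is [(c + v w, x) |-> phi x]. *)
Lemma dyad_space_frobenius v A :
  v != 0 -> dyad_space v A -> frobenius (affine_ext A).
Proof.
move=> v0 dA; have [phi phiv] := exists_dual v0.
apply: (@row_frobenius _ _ (scalar_ext A) phi).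
  move=> _ /scalar_extP[c [_ /dA[w wv ->] ->]].
  rewrite mulmxDr mul_mx_scalar mulmxA phiv mul1mx => cw0.
  (* Evaluating [c phi + w = 0] at [v] isolates [c], since [phi v = 1] and [w v = 0]. *)
  have /matrixP/(_ 0 0) : (c *: phi + w) *m v = 0 by rewrite cw0 mul0mx.
  rewrite mulmxDl wv addr0 -scalemxAl phiv !mxE mulr1 => c0.
  by move: cw0; rewrite c0 scale0r add0r => ->; rewrite mulmx0 raddf0 addr0.
move=> x x0; have phix : phi *m x = 0.
  rewrite -[x]mul1mx; apply: x0; apply/scalar_extP; exists 1, 0.
    exact: mem0v.
  by rewrite addr0.
(* Rows killing [v] together with [phi] span all rows, and [x] is killed by both kinds. *)
apply: eq0_mulmx_row => e; pose w := e - e *m v *m phi.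
have wv : w *m v = 0 by rewrite mulmxBl -!mulmxA phiv mulmx1 subrr.
have : phi *m (v *m w *m x) = 0.
  apply: x0; apply/scalar_extP; exists 0, (v *m w); last first.
    by rewrite raddf0 add0r.
  by apply/dA; exists w.
by rewrite !mulmxA phiv mul1mx mulmxBl -(mulmxA _ phi) phix mulmx0 subr0.
Qed.

(* A column [v] of some [a] in [A] is killed by [A], so nondegeneracy forces
   [phi v <> 0]; after rescaling, every [a] in [A] equals [v (phi a)]. *)
Lemma class2_frobenius_dyad A :
  mans_of_class 2 A -> frobenius (affine_ext A) ->
  exists2 v, v != 0 & dyad_space v A.
Proof.
case=> [[mA _] _ prod0 [a0 Aa0]]; rewrite expr1 => a0n /frobenius_row[phi inj].
have {}prod0 a b : a \in A -> b \in A -> a *m b = 0.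
  move=> Aa Ab; pose s (i : 'I_2) := if i == 0 then a else b.
  have := prod0 s; rewrite !big_ord_recl big_ord0 mulr1 -mulmxE; apply=> i.
  by rewrite /s; case: ifP.
have [i v0n] : exists i, col i a0 != 0.
  apply/existsP; apply: contraNT a0n; rewrite negb_exists => /forallP a00.
  apply/eqP/trmx_inj/row_matrixP => i; rewrite trmx0 row0 -tr_col.
  by move/negPn/eqP: (a00 i) => ->; rewrite trmx0.
have Acol a : a \in A -> a *m col i a0 = 0.
  by move=> Aa; rewrite colE mulmxA prod0 ?mul0mx.
pose d := (phi *m col i a0) 0 0.
have d0 : d != 0.
  apply: contra_neq v0n => d0; apply: inj => _ /scalar_extP[c [a Aa ->]].
  rewrite mulmxDl (Acol a) // addr0 mul_scalar_mx -scalemxAr.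
  by rewrite [phi *m _]mx11_scalar -/d d0 raddf0 scaler0.
pose v := d^-1 *: col i a0.
have v0 : v != 0 by rewrite scaler_eq0 invr_eq0 negb_or d0.
have phiv : phi *m v = 1%:M.
  by rewrite -scalemxAr [phi *m _]mx11_scalar -/d scale_scalar_mx mulVf.
have Av a : a \in A -> a *m v = 0.
  by move=> Aa; rewrite -scalemxAr Acol ?scaler0.
have aE a : a \in A -> a = v *m (phi *m a).
  move=> Aa; apply/eqP; rewrite -subr_eq0.
  (* Each column of [a - v (phi a)] is killed by [phi], as [phi v = 1], and by [A], as [A] kills [a]
     and [v]; [inj] makes it 0. *)
  apply/eqP/trmx_inj/row_matrixP => j; rewrite trmx0 row0 -tr_col.
  rewrite [col _ _]inj ?trmx0 // => _ /scalar_extP[c [b Ab ->]].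
  rewrite colE (mulmxA _ (a - _)) (mulmxA phi) mulmxDl mul_scalar_mx mulmxBr.
  rewrite (mulmxA b) (Av b) // mul0mx prod0 // subrr addr0.
  by rewrite -scalemxAr mulmxBr mulmxA phiv mul1mx subrr scaler0 mul0mx.
exists v => // a; split=> [Aa | [w wv ->]].
  by exists (phi *m a); [rewrite -mulmxA Av ?mulmx0 | exact: aE].
(* Maximality supplies the converse: [v w] is traceless and commutes with every [b = v (phi b)] in
   [A]. *)
have [_ _ cA] := mA; apply/cA; split.
  by rewrite mem_sl mxtrace_mulC wv mxtrace0.
move=> b Ab; rewrite /lieb /= /commutator mulmxA Av // mul0mx subr0.
by rewrite [b]aE // mulmxA -(mulmxA v) wv mulmx0 mul0mx.
Qed.

End Uniqueness.

(** * The model space and the classification *)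

(** Matrices supported on the first row are [e w] with [e] the first basis column, and [w e = 0]
    says that the first entry of [w] is 0. *)
Lemma An1_dyad (F : fieldType) (n : nat) :
  dyad_space (delta_mx 0 0 : 'cV[F]_n.+1) (An1 F n.+1).
Proof.
move=> a; split=> [/memv_sumP[f Af ->] | [w w0 ->]].
  pose w : 'rV[F]_n.+1 := row 0 (\sum_(ij : 'I_n.+1 * 'I_n.+1 |
      (ij.1 == 0%N :> nat) && (0 < ij.2)%N) f ij).
  exists w.
    rewrite /w rowE -mulmxA -colE -rowE linear_sum /= linear_sum.
    rewrite big1 //= => -[i j] Pij.
    have /vlineP[c ->] := Af _ Pij; case/andP: Pij => /= _ j0.
    rewrite !linearZ /= [X in _ *: X]mx11_scalar !mxE andbC.
    rewrite [0 == j]eq_sym; case: (j =P 0) j0 => [->|] // _ _.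
    by rewrite raddf0 scaler0.
  rewrite /w rowE mulmxA mul_delta_mx mulmx_sumr; apply: eq_bigr => -[i j] Pij.
  have /vlineP[c ->] := Af _ Pij; case/andP: Pij => /= /eqP i0 _.
  by rewrite (_ : i = 0) -?scalemxAr ?mul_delta_mx //; apply: val_inj.
rewrite [w]row_sum_delta mulmx_sumr rpred_sum // => j _.
rewrite -scalemxAr mul_delta_mx; case: (j =P 0) => [-> | j0].
  by move/matrixP/(_ 0 0): w0; rewrite -colE !mxE => ->; rewrite scale0r mem0v.
rewrite memvZ // memvE; apply: (sumv_sup (0, j)) => //=.
by rewrite lt0n; apply/eqP => j00; apply/j0/val_inj.
Qed.

Theorem theorem2 (R : realType) (n : nat) (hn : (2 <= n)%N) :
  [/\ unique_up_to (fun A A' : abelianSub 'M[R]_n => mx_conjugate A A')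
        (fun A => mans_of_class 2 A /\ frobenius (affine_ext A))
        (An1 R n),
      unique_up_to (fun A A' : abelianSub 'M[R]_n => mx_conjugate A A')
        (fun A => [/\ mans A, kravchuk_signature A = (n.-1, 0, 1%N)
                    & frobenius (affine_ext A)])
        (An1 R n),
      (forall A : abelianSub 'M[R]_n, mans A -> frobenius (affine_ext A) ->
         (mans_of_class 2 A <-> kravchuk_signature A = (n.-1, 0, 1%N)))
    & unique_up_to (fun A A' : abelianSub 'M[R]_n =>
                      lie_isomorphic (affine_ext A) (affine_ext A'))
        (fun A => [/\ mans_of_class 2 A, two_solvable (affine_ext A)
                    & frobenius (affine_ext A)])
        (An1 R n)].
Proof.
(* Characteristic 0 enters here: the trace [n c] must force [c = 0]. *)
have nR : n%:R != 0 :> R by rewrite pnatr_eq0 -lt0n ltnW.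
have [v v0 dv] : exists2 v : 'cV[R]_n, v != 0 & dyad_space v (An1 R n).
  case: n hn nR => // k _ _; exists (delta_mx 0 0); last exact: An1_dyad.
  by apply/eqP => /matrixP/(_ 0 0)/eqP; rewrite !mxE oner_eq0.
have cls := dyad_space_class2 hn nR v0 dv.
have frob := dyad_space_frobenius v0 dv.
have [mAn1 _ _ _] := cls.
have conj (A : abelianSub 'M[R]_n) :
    mans_of_class 2 A -> frobenius (affine_ext A) -> mx_conjugate A (An1 R n).
  move=> cA fA; have [w w0 dw] := class2_frobenius_dyad cA fA.
  exact: dyad_space_conjugate w0 v0 dw dv.
split.
- by split=> // A [cA fA]; apply: conj.
- split; first by split=> //; apply: dyad_space_signature dv.
  by move=> A [mA kA fA]; apply: conj => //; apply: signature_class2.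
- move=> A mA fA; split=> [cA | kA]; last exact: signature_class2.
  have [w w0 dw] := class2_frobenius_dyad cA fA.
  exact: dyad_space_signature dw.
- split; first by split=> //; apply: semidirect_two_solvable.
  move=> A [cA _ fA]; apply/conjugate_isomorphic/scalar_ext_conjugate.
  exact: conj.
Qed.
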